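(* Let $H$ be a graph with vertex set $\{1,\dots,p\}$, let $G_1,\dots,G_p$ be arbitrary graphs with $|V(G_i)|=n_i$, and let $G=\bigvee_H\{G_1,\dots,G_p\}$ be their $H$-join. For each $i$, write $$\sigma(G_i)=\{\mu_{i,1}^{[m_{i,1}]},\dots,\mu_{i,s_i}^{[m_{i,s_i}]},\mu_{i,s_i+1}^{[m_{i,s_i+1}]},\dots,\mu_{i,t_i}^{[m_{i,t_i}]}\},$$ where $\mu_{i,1},\dots,\mu_{i,t_i}$ are the distinct eigenvalues of $G_i$, $m_{i,j}$ is the multiplicity of $\mu_{i,j}$, and $\mu_{i,1},\dots,\mu_{i,s_i}$ are exactly the main eigenvalues of $G_i$. Then, as multisets (unions counted with multiplicity, and an exponent $[0]$ meaning the element does not appear), $$\sigma(G)=\bigcup_{i=1}^p\{\mu_{i,1}^{[m_{i,1}-1]},\dots,\mu_{i,s_i}^{[m_{i,s_i}-1]}\}\ \cup\ \bigcup_{i=1}^p\{\mu_{i,s_i+1}^{[m_{i,s_i+1}]},\dots,\mu_{i,t_i}^{[m_{i,t_i}]}\}\ \cup\ \sigma(\widetilde{\mathbf W}),$$ where $\widetilde{\mathbf W}$ is the $H$-join associated matrix defined below.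
   Context: All graphs are undirected, simple and finite. The $H$-join $G=\bigvee_H\{G_1,\dots,G_p\}$ has vertex set the disjoint union of the $V(G_j)$ and edge set consisting of all edges of the $G_j$ together with all edges joining every vertex of $G_r$ to every vertex of $G_s$ for each edge $rs\in E(H)$. $A(\cdot)$ is the adjacency matrix, $\sigma(\cdot)$ the spectrum (multiset of eigenvalues), $\mathbf{j}_n$ the all-ones vector of length $n$. An eigenvalue $\mu$ of a graph $G'$ of order $n$ is main if its eigenspace is not orthogonal to $\mathbf{j}_n$. If $G'$ has distinct main eigenvalues $\mu_1,\dots,\mu_s$, its main characteristic polynomial is $m_{G'}(x)=\prod_{k=1}^s(x-\mu_k)=x^s-c_0-c_1x-\dots-c_{s-1}x^{s-1}$. The walk-matrix of $G'$ is the $n\times s$ matrix $\mathbf W_{G'}=(\mathbf j_n, A(G')\mathbf j_n,\dots,A(G')^{s-1}\mathbf j_n)$, where $s$ is the largest $k$ for which $\mathbf j_n,A(G')\mathbf j_n,\dots,A(G')^{k-1}\mathbf j_n$ are linearly independent (this $s$ equals the number of main eigenvalues). For $G_i$ write $m_{G_i}(x)=x^{s_i}-c_{i,0}-c_{i,1}x-\dots-c_{i,s_i-1}x^{s_i-1}$. Let $\delta_{i,j}=1$ if $ij\in E(H)$ and $0$ otherwise. Let $\mathbf C(m_{G_i})$ be the $s_i\times s_i$ matrix with ones on the subdiagonal (entries $(k+1,k)$), last column $(c_{i,0},c_{i,1},\dots,c_{i,s_i-1})^T$, and zeros elsewhere. For $i\ne j$ let $\mathbf M_{i,j}$ be the $s_i\times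 s_j$ matrix whose first row is $\mathbf j_{n_j}^T\mathbf W_{G_j}$ and whose other rows are zero. The $H$-join associated matrix is the $s\times s$ block matrix $\widetilde{\mathbf W}$, $s=\sum_i s_i$, whose $(i,i)$ diagonal block is $\mathbf C(m_{G_i})$ and whose $(i,j)$ off-diagonal block is $\delta_{i,j}\mathbf M_{i,j}$. *)

(* Defs.v *)
From HB Require Import structures.
From mathcomp Require Import all_boot all_order all_algebra.

Set Implicit Arguments.
Unset Strict Implicit.
Unset Printing Implicit Defensive.

Import GRing.Theory.
Local Open Scope ring_scope.

Record sgraph (V : finType) := SGraph {
  edge :> rel V;
  edge_sym : symmetric edge;
  edge_irrefl : irreflexive edge }.

Section HJoin.
Variables (p : nat) (H : sgraph 'I_p) (V : 'I_p -> finType).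
Variable G : forall i, sgraph (V i).

(* [tagged_as u v] is [tagged v] transported to [V (tag u)]; it is only
   relevant when [tag u = tag v]. *)
Definition hjoin_edge : rel {i : 'I_p & V i} := fun u v =>
  (tag u == tag v) && G (tag u) (tagged u) (tagged_as u v)
  || H (tag u) (tag v).

Lemma hjoin_sym : symmetric hjoin_edge.
Proof.
move=> [i x] [j y]; rewrite /hjoin_edge /= [H i j]edge_sym; congr orb.
rewrite [j == i]eq_sym; have [eq_ij | //] := eqVneq i j.
by case: j / eq_ij y => y; rewrite !tagged_asE edge_sym.
Qed.

Lemma hjoin_irrefl : irreflexive hjoin_edge.
Proof. by move=> [i x]; rewrite /hjoin_edge /= tagged_asE !edge_irrefl andbF. Qed.

Definition hjoin : sgraph {i : 'I_p & V i} := SGraph hjoin_sym hjoin_irrefl.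

End HJoin.

Section Spectrum.
Variable C : numClosedFieldType.

(* Eigenvalues listed with algebraic multiplicity; the order is irrelevant and
   multisets are compared with [perm_eq]. *)
Definition spectrum n (A : 'M[C]_n) : seq C :=
  sval (closed_field_poly_normal (char_poly A)).

Definition ones n : 'cV[C]_n := const_mx 1.

Variables (V : finType) (G : sgraph V).

Definition adjmx : 'M[C]_#|V| :=
  \matrix_(i, j) (G (enum_val i) (enum_val j))%:R.

(* [eigenspace] consists of row vectors, which for the symmetric matrix [adjmx]
   are the transposed column eigenvectors. *)
Definition main_eigenvalue (mu : C) : bool :=
  eigenvalue adjmx mu && (eigenspace adjmx mu *m ones #|V| != 0).

Definition main_eigenvalues : seq C :=
  undup [seq mu <- spectrum adjmx | main_eigenvalue mu].

Definition main_poly : {poly C} :=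
  \prod_(mu <- main_eigenvalues) ('X - mu%:P).

(* m_G(x) = x^s - c_0 - c_1 x - ... - c_(s-1) x^(s-1) *)
Definition main_coef (k : nat) : C := - main_poly`_k.

Definition walk_cols (k : nat) : 'M[C]_(#|V|, k) :=
  \matrix_(u, l) (adjmx ^+ l *m ones #|V|) u 0.

(* The largest k such that j, A j, ..., A^(k-1) j are linearly independent; this
   forces k <= #|V|, so the bound on the range loses nothing. *)
Definition walk_dim : nat :=
  \max_(k < #|V|.+1 | row_free (walk_cols k)^T) k.

Definition walk_mx : 'M[C]_(#|V|, walk_dim) := walk_cols walk_dim.

Definition main_companion : 'M[C]_walk_dim :=
  \matrix_(k, l) if l.+1 == walk_dim then main_coef k else (k == l.+1 :> nat)%:R.

End Spectrum.

Section AssociatedMatrix.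
Variables (C : numClosedFieldType) (p : nat) (H : sgraph 'I_p).
Variables (V : 'I_p -> finType) (G : forall i, sgraph (V i)).

Local Notation s i := (walk_dim C (G i)).

Definition hjoin_offdiag (i j : 'I_p) : 'M[C]_(s i, s j) :=
  \matrix_(k, l)
    if k == 0%N :> nat then ((ones C #|V j|)^T *m walk_mx C (G j)) 0 l else 0.

(* The diagonal blocks of the second summand vanish since [H] is irreflexive. *)
Definition hjoin_assoc_mx : 'M[C]_(\sum_(i < p) s i) :=
  \mxdiag_(i < p) main_companion C (G i)
  + \mxblock_(i < p, j < p) ((H i j)%:R *: hjoin_offdiag i j).

End AssociatedMatrix.

(* Main.v *)
Require Import Defs.
From HB Require Import structures.
From mathcomp Require Import all_boot all_order all_algebra.
From mathcomp Require Import perm.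

Set Implicit Arguments.
Unset Strict Implicit.
Unset Printing Implicit Defensive.

Import Order.TTheory GRing.Theory Num.Theory.
Local Open Scope ring_scope.

(* Let W_i be the walk matrix of G_i.  Since A(G_i) is symmetric, the column space
   of W_i and its orthogonal complement, with basis Z_i, are both invariant:
   A(G_i) W_i = W_i C(m_{G_i}) because m_{G_i} is the minimal polynomial of j with
   respect to A(G_i), and A(G_i) Z_i = Z_i D_i.  As j is the first column of W_i,
   j^T Z_i = 0, so the all-ones blocks of A(G) kill every Z_i and map W_j to
   W_i M_{i,j}.  Hence in the basis formed by all W_i and all Z_i the matrix A(G)
   becomes the block sum of the associated matrix and the D_i, while
   char(A(G_i)) = m_{G_i} char(D_i) identifies the spectrum of D_i. *)

(** * Characteristic polynomials under change of basis and of index set *)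

Section CharPoly.
Variable F : fieldType.

Lemma mulmx1C_eq_dim m n (X : 'M[F]_(m, n)) (Y : 'M[F]_(n, m)) :
  m = n -> X *m Y = 1%:M -> Y *m X = 1%:M.
Proof. by move=> e; case: n / e X Y => X Y; apply: mulmx1C. Qed.

Lemma char_poly_tr n (A : 'M[F]_n) : char_poly A^T = char_poly A.
Proof.
rewrite /char_poly -det_tr; congr (\det _); apply/matrixP=> i j.
by rewrite !mxE eq_sym.
Qed.

Lemma char_poly_cast m n (e : m = n) (A : 'M[F]_m) :
  char_poly (castmx (e, e) A) = char_poly A.
Proof. by case: n / e; rewrite castmx_id. Qed.

Lemma char_poly_block_diag m n (A : 'M[F]_m) (D : 'M[F]_n) :
  char_poly (block_mx A 0 0 D) = char_poly A * char_poly D.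
Proof.
rewrite /char_poly -(det_ublock _ 0); congr (\det _).
rewrite /char_poly_mx scalar_mx_block map_block_mx !map_mx0 opp_block_mx.
by rewrite add_block_mx !oppr0 !addr0.
Qed.

(** The two sizes are kept apart because the order of a graph is only provably equal to the number
    of vectors in a basis split into blocks; the ranks of [P *m Q] and [Q *m P] force them to
    agree. *)
Lemma char_poly_similar m n (A : 'M[F]_m) (B : 'M[F]_n)
    (P : 'M[F]_(m, n)) (Q : 'M[F]_(n, m)) :
  P *m Q = 1%:M -> Q *m P = 1%:M -> A *m P = P *m B ->
  char_poly A = char_poly B.
Proof.
move=> PQ QP APB; have emn : m = n.
  apply/eqP; rewrite eqn_leq -{1}(mxrank1 F m) -{2}(mxrank1 F n) -PQ -QP.
  by rewrite !(leq_trans (mxrankM_maxl _ _) (rank_leq_col _)).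
case: n / emn B P Q PQ QP APB => B P Q PQ QP APB.
pose f := map_mx (@polyC F).
have detPQ : \det (f _ _ P) * \det (f _ _ Q) = 1.
  by rewrite -det_mulmx -map_mxM PQ map_mx1 det1.
have E : char_poly_mx A *m f _ _ P = f _ _ P *m char_poly_mx B.
  by rewrite mulmxBl mulmxBr -!map_mxM APB scalar_mxC.
move/(congr1 determinant): E; rewrite !det_mulmx => E.
by rewrite /char_poly -[LHS]mulr1 -detPQ mulrA E mulrAC detPQ mul1r.
Qed.

(** [f] is a permutation acting on rows and columns alike, so its sign enters the determinant twice
    and cancels. *)
Lemma char_poly_reindex m n (A : 'M[F]_m) (B : 'M[F]_n) (f : 'I_m -> 'I_n) :
  m = n -> injective f -> (forall i j, A i j = B (f i) (f j)) ->
  char_poly A = char_poly B.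
Proof.
move=> emn; case: n / emn B f => B f f_inj AB.
pose s := perm f_inj.
have -> : char_poly A = \det (row_perm s (col_perm s (char_poly_mx B))).
  by congr (\det _); apply/matrixP=> i j; rewrite !mxE !permE AB (inj_eq f_inj).
rewrite row_permE col_permE !det_mulmx !det_perm odd_permV mulrCA.
by rewrite -signr_addb addbb mulr1.
Qed.

Lemma char_poly_mxdiag p (n : 'I_p -> nat) (D : forall i, 'M[F]_(n i)) :
  char_poly (\mxdiag_i D i) = \prod_i char_poly (D i).
Proof.
elim: p => [|p IHp] in n D *.
  have e : (\sum_(i < 0) n i = 0)%N by rewrite big_ord0.
  by rewrite -(char_poly_cast e) [RHS]big_ord0; apply: det_mx00.
by rewrite mxdiag_recl char_poly_cast char_poly_block_diag IHp big_ord_recl.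
Qed.

End CharPoly.

(** * Block diagonal matrices with rectangular blocks *)

Section RectangularBlockDiagonal.
Variables (F : fieldType) (p : nat).

(** [conform_mx] only retypes [B i] from width [n i] to width [n j]; its default [0] is never
    returned, as [i = j] in that branch. *)
Definition mxrdiag (m n : 'I_p -> nat) (B : forall i, 'M[F]_(m i, n i)) :
    'M[F]_(\sum_i m i, \sum_i n i) :=
  \mxblock_(i, j) if i == j then conform_mx 0 (B i) else 0.

Lemma mul_mxblock_mxrdiag (l m n : 'I_p -> nat)
    (A : forall i j, 'M[F]_(l i, m j)) (B : forall i, 'M[F]_(m i, n i)) :
  \mxblock_(i, j) A i j *m mxrdiag B = \mxblock_(i, j) (A i j *m B j).
Proof.
rewrite mul_mxblock; apply/eq_mxblock => i j.
rewrite (bigD1 j) //= eqxx conform_mx_id big1 ?addr0 // => k /negPf->.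
exact: mulmx0.
Qed.

Lemma mul_mxrdiag_mxblock (l m n : 'I_p -> nat)
    (A : forall i, 'M[F]_(l i, m i)) (B : forall i j, 'M[F]_(m i, n j)) :
  mxrdiag A *m \mxblock_(i, j) B i j = \mxblock_(i, j) (A i *m B i j).
Proof.
rewrite mul_mxblock; apply/eq_mxblock => i j.
rewrite (bigD1 i) //= eqxx conform_mx_id big1 ?addr0 // => k.
by rewrite eq_sym => /negPf->; rewrite mul0mx.
Qed.

Lemma mul_mxrdiag (l m n : 'I_p -> nat)
    (A : forall i, 'M[F]_(l i, m i)) (B : forall i, 'M[F]_(m i, n i)) :
  mxrdiag A *m mxrdiag B = mxrdiag (fun i => A i *m B i).
Proof.
rewrite mul_mxrdiag_mxblock; apply/eq_mxblock => i j.
by have [<-|_] := eqVneq i j; rewrite ?conform_mx_id // mulmx0.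
Qed.

Lemma mxrdiagD (m n : 'I_p -> nat) (A B : forall i, 'M[F]_(m i, n i)) :
  mxrdiag A + mxrdiag B = mxrdiag (fun i => A i + B i).
Proof.
rewrite -mxblockD; apply/eq_mxblock => i j.
by have [<-|_] := eqVneq i j; rewrite ?conform_mx_id // addr0.
Qed.

Lemma eq_mxrdiag (m n : 'I_p -> nat) (A B : forall i, 'M[F]_(m i, n i)) :
  (forall i, A i = B i) -> mxrdiag A = mxrdiag B.
Proof. by move=> AB; apply/eq_mxblock => i j; rewrite AB. Qed.

Lemma mxrdiag0 (m n : 'I_p -> nat) :
  mxrdiag (fun i => 0 : 'M[F]_(m i, n i)) = 0.
Proof.
rewrite -mxblock0; apply/eq_mxblock => i j.
by have [<-|//] := eqVneq i j; rewrite conform_mx_id.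
Qed.

Lemma mxrdiag1 (m : 'I_p -> nat) :
  mxrdiag (fun i => 1%:M : 'M[F]_(m i)) = 1%:M.
Proof. exact: mxdiagZ. Qed.

(* In the basis [row_mx (mxrdiag W) (mxrdiag Z)] the perturbation [B] only acts
   on the span of the [W i], hence the matrix becomes block diagonal. *)
Lemma char_poly_mxblock_split (n s r : 'I_p -> nat)
    (A : forall i, 'M[F]_(n i)) (B : forall i j, 'M[F]_(n i, n j))
    (C : forall i, 'M[F]_(s i)) (M : forall i j, 'M[F]_(s i, s j))
    (D : forall i, 'M[F]_(r i))
    (W : forall i, 'M[F]_(n i, s i)) (Z : forall i, 'M[F]_(n i, r i))
    (Y : forall i, 'M[F]_(s i + r i, n i)) :
  (forall i, row_mx (W i) (Z i) *m Y i = 1%:M) ->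
  (forall i, Y i *m row_mx (W i) (Z i) = 1%:M) ->
  (forall i, A i *m W i = W i *m C i) ->
  (forall i, A i *m Z i = Z i *m D i) ->
  (forall i j, B i j *m W j = W i *m M i j) ->
  (forall i j, B i j *m Z j = 0) ->
  char_poly (\mxdiag_i A i + \mxblock_(i, j) B i j)
    = char_poly (\mxdiag_i C i + \mxblock_(i, j) M i j)
      * \prod_i char_poly (D i).
Proof.
move=> XY YX AW AZ BW BZ.
(* The two halves of [Y i] give the coordinates along [W i] and along [Z i]. *)
have YXb i : [/\ usubmx (Y i) *m W i = 1%:M, usubmx (Y i) *m Z i = 0,
                 dsubmx (Y i) *m W i = 0 & dsubmx (Y i) *m Z i = 1%:M].
  have := YX i; rewrite -{1}[Y i]vsubmxK mul_col_row scalar_mx_block.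
  by case/eq_block_mx.
rewrite -char_poly_mxdiag -char_poly_block_diag.
apply: (char_poly_similar (P := row_mx (mxrdiag W) (mxrdiag Z))
  (Q := col_mx (mxrdiag (fun i => usubmx (Y i)))
               (mxrdiag (fun i => dsubmx (Y i))))).
- rewrite mul_row_col !mul_mxrdiag mxrdiagD -mxrdiag1.
  by apply: eq_mxrdiag => i; rewrite -mul_row_col vsubmxK.
- rewrite mul_col_row !mul_mxrdiag scalar_mx_block -!mxrdiag1 -!mxrdiag0.
  by congr block_mx; apply: eq_mxrdiag => i; case: (YXb i).
rewrite mul_mx_row mul_row_block !mulmx0 addr0 add0r !mulmxDl !mulmxDr.
rewrite !mul_mxblock_mxrdiag !mul_mxrdiag_mxblock.
congr row_mx; [congr (_ + _)|rewrite [X in _ + X](_ : _ = 0) ?addr0].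
- apply/eq_mxblock => i j; have [<-|_] := eqVneq i j;
    last by rewrite ?mulmx0 ?mul0mx.
  by rewrite !conform_mx_id AW.
- by apply/eq_mxblock => i j; rewrite BW.
- apply/eq_mxblock => i j; have [<-|_] := eqVneq i j;
    last by rewrite ?mulmx0 ?mul0mx.
  by rewrite !conform_mx_id AZ.
by rewrite -mxblock0; apply/eq_mxblock => i j; rewrite BZ.
Qed.

End RectangularBlockDiagonal.

(** * Spectra, Gram matrices and left eigenvectors *)

Section Spectrum.
Variable C : numClosedFieldType.

Lemma char_poly_spectrum n (A : 'M[C]_n) :
  char_poly A = \prod_(x <- spectrum A) ('X - x%:P).
Proof.
rewrite /spectrum; case: closed_field_poly_normal => /= r.
by rewrite (monicP (char_poly_monic A)) scale1r.
Qed.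

Lemma mem_spectrum n (A : 'M[C]_n) a : (a \in spectrum A) = eigenvalue A a.
Proof. by rewrite eigenvalue_root_char char_poly_spectrum root_prod_XsubC. Qed.

(** If [u] kills the Gram matrix, then [u *m W^T] has Hermitian norm zero, since conjugation fixes
    the real matrix [W]. *)
Lemma real_gram_unit m n (W : 'M[C]_(n, m)) :
  W \is a realmx -> row_free W^T -> W^T *m W \in unitmx.
Proof.
move=> Wreal Wfree; rewrite -row_free_unit; apply: inj_row_free => u uG.
apply: (row_free_inj Wfree); rewrite mul0mx.
apply/eqP; apply: contraTT (lexx (0 : C)) => /dotmx_is_dotmx.
rewrite dotmxE trmx_mul map_mxM trmxK (realmxC Wreal) mulmxA -[_ *m _ *m W]mulmxA.
by rewrite uG mul0mx mxE ltxx.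
Qed.

(** Used in two ways: if [a] is a root of [f], then [v] annihilates [f(A) x]; if [f(A) x = 0] and
    [v *m x] is nonzero, then [a] is a root of [f]. *)
Lemma left_eigenvector_poly n (A : 'M[C]_n) (x : 'cV[C]_n) (v : 'rV[C]_n) a
    (f : {poly C}) :
  v *m A = a *: v ->
  v *m (\sum_(k < size f) f`_k *: (A ^+ k *m x)) = f.[a] *: (v *m x).
Proof.
move=> vA; rewrite mulmx_sumr horner_coef scaler_suml; apply: eq_bigr => k _.
rewrite -scalemxAr -scalerA; congr (_ *: _); elim: (k : nat) => [|l IHl].
  by rewrite expr0 mul1mx scale1r.
by rewrite exprS -mulmxE !mulmxA vA -!scalemxAl -mulmxA IHl scalerA exprS.
Qed.

End Spectrum.

(** * Main eigenvalues, the walk matrix and its orthogonal complement *)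

Section MainPart.
Variables (C : numClosedFieldType) (V : finType) (G : sgraph V).

Local Notation n := #|V|.
Local Notation A := (adjmx C G).
Local Notation j := (ones C #|V|).
Local Notation d := (walk_dim C G).
Local Notation W := (walk_mx C G).
Local Notation f := (main_poly C G).

Lemma adjmx_tr : A^T = A.
Proof. by apply/matrixP=> i k; rewrite !mxE edge_sym. Qed.

Lemma adjmx_real : A \is a realmx.
Proof. by apply/mxOverP=> i k; rewrite mxE realn. Qed.

Lemma walk_cols_real k : walk_cols C G k \is a realmx.
Proof.
apply/mxOverP=> i l; rewrite mxE; apply: mxOverP.
have jreal : j \is a realmx by apply/mxOverP=> ? ?; rewrite mxE real1.
by elim: (l : nat) => [|q IHq]; rewrite ?mul1mx // exprS -mulmxA mxOverM ?adjmx_real.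
Qed.

Lemma mem_main_eigenvalues mu :
  (mu \in main_eigenvalues C G) = main_eigenvalue G mu.
Proof.
rewrite mem_undup mem_filter mem_spectrum /main_eigenvalue.
by case: eigenvalue; rewrite ?andbT.
Qed.

Lemma main_eigenvectorP mu :
  reflect (exists2 v : 'rV[C]_n, v *m A = mu *: v & v *m j != 0)
          (main_eigenvalue G mu).
Proof.
apply: (iffP andP) => [[_] | [v vA vj]].
  case/matrix0Pn => i [k].
  move=> Ej; exists (row i (eigenspace A mu)).
    by apply/eigenspaceP/row_sub.
  apply: contraNneq Ej; rewrite -row_mul => /rowP/(_ k).
  by rewrite mxE [RHS]mxE => ->.
have /eigenspaceP vE := vA.
split.
  by apply/eigenvalueP; exists v => //; apply: contraNneq vj => ->; rewrite mul0mx.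
by apply: contraNneq vj => E0; case/submxP: vE => u ->; rewrite -mulmxA E0 mulmx0.
Qed.

(* Test against an eigenbasis of the symmetric matrix: at a non-main eigenvector
   the component of [j] vanishes, at a main one the polynomial does. *)
Lemma main_poly_annihilates : \sum_(k < size f) f`_k *: (A ^+ k *m j) = 0.
Proof.
have /orthomx_spectralP : A \is normalmx.
  apply: symmetric_normalmx; last exact: adjmx_real.
  by apply/is_hermitianmxP; rewrite expr0 scale1r map_mx_id // adjmx_tr.
set P := spectralmx A; set D := spectral_diag A => AE.
have Punit : P \in unitmx by apply: spectral_unit.
have PA : P *m A = diag_mx D *m P by rewrite {1}AE !mulmxA mulmxV // mul1mx.
set y := \sum_(k < _) _.
suff Py : P *m y = 0 by rewrite -[y](mulKmx Punit) Py mulmx0.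
apply/row_matrixP=> i; rewrite row0 row_mul.
have vA : row i P *m A = D 0 i *: row i P.
  by rewrite -row_mul PA mul_diag_mx; apply/rowP=> k; rewrite !mxE.
rewrite (left_eigenvector_poly _ _ vA).
have [->|vj] := eqVneq (row i P *m j) 0; first exact: scaler0.
have : root f (D 0 i).
  rewrite root_prod_XsubC mem_main_eigenvalues; apply/main_eigenvectorP.
  by exists (row i P).
by move/rootP=> ->; rewrite scale0r.
Qed.

Lemma size_main_poly : size f = (size (main_eigenvalues C G)).+1.
Proof. exact: size_prod_XsubC. Qed.

Lemma mul_walk_cols k (u : 'rV[C]_k) :
  walk_cols C G k *m u^T = \sum_(l < k) u 0 l *: (A ^+ l *m j).
Proof.
apply/matrixP=> i q; rewrite mxE summxE; apply: eq_bigr => l _.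
by rewrite !mxE mulrC ord1.
Qed.

(* A vanishing combination of walk vectors is a polynomial killing [j], hence
   one that vanishes at every main eigenvalue. *)
Lemma walk_cols_free k :
  row_free (walk_cols C G k)^T = (k <= size (main_eigenvalues C G))%N.
Proof.
apply/idP/idP => [Wfree | le_k].
  rewrite leqNgt; apply/negP=> lt_k.
  (* The coefficients of [f], padded with zeros, form a dependency between the walk columns,
     although the leading one is 1. *)
  pose u : 'rV[C]_k := \row_(l < k) f`_l.
  have u0 : u = 0.
    apply: (row_free_inj Wfree); rewrite mul0mx; apply: trmx_inj.
    rewrite trmx_mul trmxK trmx0 mul_walk_cols -[RHS]main_poly_annihilates.
    rewrite (big_ord_widen k (fun l => f`_l *: (A ^+ l *m j))) ?size_main_poly //.
    rewrite [RHS]big_mkcond /=; apply: eq_bigr => l _; rewrite mxE.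
    by case: ltnP => // ?; rewrite nth_default ?scale0r ?size_main_poly.
  have /rowP/(_ (Ordinal lt_k)) := u0; rewrite !mxE /=.
  have /eqP := monic_prod_XsubC (main_eigenvalues C G) xpredT id.
  rewrite /lead_coef -/f size_main_poly /= => -> /eqP.
  by rewrite oner_eq0.
apply: inj_row_free => u uW.
set g := rVpoly u.
have gj : \sum_(l < size g) g`_l *: (A ^+ l *m j) = 0.
  have /(congr1 trmx) := uW; rewrite trmx_mul trmxK trmx0 mul_walk_cols => uj.
  rewrite -[RHS]uj.
  rewrite (big_ord_widen k (fun l => g`_l *: (A ^+ l *m j))) ?size_poly //.
  rewrite big_mkcond /=; apply: eq_bigr => l _.
  rewrite -[u in RHS]rVpolyK mxE -/g.
  by case: ltnP => // ?; rewrite nth_default ?scale0r.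
suff g0 : g = 0 by rewrite -[u]rVpolyK -/g g0 linear0.
(* A nonzero [g] has size at most [k] but greater than the number of its distinct roots, among which
   are all main eigenvalues. *)
apply/eqP; apply: contraLR le_k => g_neq0; rewrite -ltnNge.
apply: leq_trans (size_poly _ _ : (size g <= k)%N).
apply: max_poly_roots => //; last exact: undup_uniq.
apply/allP=> mu; rewrite mem_main_eigenvalues => /main_eigenvectorP[v vA vj].
have := left_eigenvector_poly j g vA; rewrite gj mulmx0 => /esym/eqP.
by rewrite scaler_eq0 (negPf vj) orbF.
Qed.

Lemma walk_dimE : d = size (main_eigenvalues C G).
Proof.
apply/eqP; rewrite eqn_leq; apply/andP; split.
  by apply/bigmax_leqP=> k; rewrite walk_cols_free.
have free_s : row_free (walk_cols C G (size (main_eigenvalues C G)))^T.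
  by rewrite walk_cols_free.
(* Independent columns number at most [#|V|], so this candidate lies in the range of the maximum. *)
have lt_s : (size (main_eigenvalues C G) < #|V|.+1)%N.
  by rewrite ltnS; move: free_s; rewrite /row_free => /eqP {1}<-; apply: rank_leq_col.
exact: (@leq_bigmax_cond _ _ (fun k : 'I__ => k : nat) (Ordinal lt_s)).
Qed.

Lemma walk_mx_free : row_free W^T.
Proof. by rewrite walk_cols_free walk_dimE. Qed.

Lemma char_poly_main_companion : char_poly (main_companion C G) = f.
Proof.
have e : d = (size f).-1 by rewrite size_main_poly walk_dimE.
(* Up to the cast, [main_companion] is the transpose of [companionmx f]. *)
rewrite -(char_poly_cast e) -[RHS]companionmxK ?monic_prod_XsubC //.
rewrite -[RHS]char_poly_tr; congr char_poly.
apply/matrixP=> k l; rewrite castmxE !mxE /= [k == l.+1 :> nat]eq_sym.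
have s_gt0 : (0 < (size f).-1)%N by apply: leq_ltn_trans (ltn_ord l).
suff -> : (l.+1 == d) = (l == (size f).-1.-1 :> nat) by [].
by rewrite e -[RHS]eqSS prednK.
Qed.

(** [A] shifts each walk vector to the next one; past the last column, [A^d j] is expanded by the
    relation [m_G(A) j = 0]. *)
Lemma adjmx_walk_mx : A *m W = W *m main_companion C G.
Proof.
apply/matrixP=> i l; rewrite !mxE.
transitivity ((A ^+ l.+1 *m j) i 0).
  rewrite exprS -mulmxE -mulmxA [RHS]mxE; apply: eq_bigr => k _.
  by rewrite [W _ _]mxE.
under eq_bigr => k _ do rewrite [W _ _]mxE [main_companion _ _ _ _]mxE.
have [el|ne_l] := eqVneq l.+1 d; last first.
  have lt_l : (l.+1 < d)%N by rewrite ltn_neqAle ne_l ltn_ord.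
  rewrite (bigD1 (Ordinal lt_l)) //= eqxx mulr1 big1 ?addr0 // => k.
  by rewrite -val_eqE /= => /negPf->; rewrite mulr0.
have := main_poly_annihilates; rewrite size_main_poly -walk_dimE big_ord_recr /=.
have -> : f`_d = 1.
  have /eqP := monic_prod_XsubC (main_eigenvalues C G) xpredT id.
  by rewrite /lead_coef -/f size_main_poly -walk_dimE.
rewrite scale1r el addrC => /eqP; rewrite addr_eq0 => /eqP->.
rewrite mxE summxE -sumrN; apply: eq_bigr => k _.
by rewrite [X in - X]mxE /main_coef mulrN mulrC.
Qed.

(* Orthogonality is bilinear, without conjugation; this gives a true complement
   of the span of the walk vectors because these vectors are real. *)
Definition walk_perp : 'M[C]_(\rank (kermx W), n) := row_base (kermx W).

(** The action of [A] on the complement: [pinvmx] reads off coordinates in the rows of [walk_perp],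
    and the transpose passes to column vectors. *)
Definition perp_adjmx : 'M[C]_(\rank (kermx W)) :=
  (walk_perp *m A *m pinvmx walk_perp)^T.

Definition walk_basis : 'M[C]_(n, d + \rank (kermx W)) := row_mx W walk_perp^T.

Lemma walk_perpP : walk_perp *m W = 0.
Proof. by apply/sub_kermxP; rewrite eq_row_base. Qed.

(** By symmetry of [A] it suffices that [v W = 0] implies [v A W = v W C = 0]. *)
Lemma adjmx_perp : A *m walk_perp^T = walk_perp^T *m perp_adjmx.
Proof.
apply: trmx_inj; rewrite !trmx_mul !trmxK adjmx_tr mulmxKpV //.
rewrite eq_row_base; apply/sub_kermxP.
by rewrite -mulmxA adjmx_walk_mx mulmxA walk_perpP mul0mx.
Qed.

(** Multiplying a vanishing combination by [W] removes its [walk_perp] part and leaves the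
    invertible Gram matrix of [W]; rank-nullity then makes the basis square. The sigma type lets an
    inverse be selected for every graph of the join. *)
Lemma walk_basis_inv :
  {Y | walk_basis *m Y = 1%:M & Y *m walk_basis = 1%:M}.
Proof.
have Wfree := walk_mx_free.
have Bfree : row_free walk_basis^T.
  apply: inj_row_free => u; rewrite tr_row_mx trmxK -[u]hsubmxK mul_row_col => uB.
  have u1 : lsubmx u = 0.
    have Gunit := real_gram_unit (walk_cols_real _) Wfree.
    have /(congr1 (mulmx^~ W)) := uB.
    rewrite mulmxDl -[_ *m W]mulmxA -[_ *m _ *m W]mulmxA walk_perpP.
    rewrite mulmx0 addr0 mul0mx => uG.
    by rewrite -[lsubmx u](mulmxK Gunit) uG mul0mx.
  have u2 : rsubmx u = 0.
    move: uB; rewrite u1 mul0mx add0r => uB.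
    by apply: (row_free_inj (row_base_free _)); rewrite mul0mx.
  by rewrite u1 u2 row_mx0.
have e : n = (d + \rank (kermx W))%N.
  rewrite mxrank_ker -mxrank_tr (eqP Wfree) subnKC //.
  by rewrite -(eqP Wfree) rank_leq_col.
have YX : (pinvmx walk_basis^T)^T *m walk_basis = 1%:M.
  by apply: trmx_inj; rewrite trmx_mul trmxK mulmxVp // trmx1.
by exists (pinvmx walk_basis^T)^T => //; apply: mulmx1C_eq_dim YX.
Qed.

Lemma char_poly_adjmx : char_poly A = f * char_poly perp_adjmx.
Proof.
have [Y XY YX] := walk_basis_inv.
rewrite -char_poly_main_companion -char_poly_block_diag.
apply: (char_poly_similar XY YX).
rewrite mul_mx_row mul_row_block !mulmx0 addr0 add0r.
by rewrite adjmx_walk_mx adjmx_perp.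
Qed.

Lemma walk_mx_first : W *m (\col_k (k == 0%N :> nat)%:R) = j.
Proof.
apply/matrixP=> i q; rewrite ord1 mxE.
have [d_gt0 | d_le0] := ltnP 0 d.
  rewrite (bigD1 (Ordinal d_gt0)) //= big1 ?addr0 => [|k].
    by rewrite [W _ _]mxE mul1mx !mxE mulr1.
  by rewrite -val_eqE /= => /negPf k_neq0; rewrite [X in _ * X]mxE k_neq0 mulr0.
(* Without walk columns [main_poly] is 1, so the annihilation relation reads [j = 0], absurd at the
   entry [i]. *)
have m0 : main_eigenvalues C G = [::].
  by apply/nilP; rewrite /nilp -walk_dimE -leqn0.
have := main_poly_annihilates.
rewrite /main_poly m0 big_nil size_poly1 big_ord1 coef1 scale1r mul1mx.
by move/matrixP/(_ i 0)/eqP; rewrite !mxE oner_eq0.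
Qed.

Lemma ones_perp : j^T *m walk_perp^T = 0.
Proof.
by rewrite -trmx_mul -walk_mx_first mulmxA walk_perpP mul0mx trmx0.
Qed.

End MainPart.

(** * Block form of the adjacency matrix of the join *)

Section Join.
Variables (C : numClosedFieldType) (p : nat) (H : sgraph 'I_p).
Variables (V : 'I_p -> finType) (G : forall i, sgraph (V i)).

Lemma char_poly_hjoin_blocks :
  char_poly (adjmx C (hjoin H G))
    = char_poly (\mxdiag_i adjmx C (G i)
                 + \mxblock_(i, j) ((H i j)%:R *: const_mx 1)).
Proof.
(* [g] matches the block-by-block order of the vertices with the enumeration of the tagged sum. *)
pose g (k : 'I_(\sum_i #|V i|)) :=
  enum_rank (Tagged V (enum_val (tagnat.sig2 k))).
have g_inj : injective g.
  move=> k l /enum_rank_inj eq_kl; apply: tagnat.sig_inj; move: eq_kl.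
  rewrite !tagnat.sigE12; move: (tagnat.sig2 k) (tagnat.sig2 l).
  move: (tagnat.sig1 k) (tagnat.sig1 l) => i j x y eq_xy.
  have eq_ij : i = j := congr1 tag eq_xy.
  case: j / eq_ij y eq_xy => y /eqP.
  by rewrite eq_Tagged /= => /eqP/enum_val_inj->.
apply/esym/(char_poly_reindex (f := g)) => // [|k l].
  by rewrite card_tagged sumnE big_map big_enum.
rewrite !mxE !enum_rankK /= /hjoin_edge /= mulr1.
move: (tagnat.sig2 k) (tagnat.sig2 l).
move: (tagnat.sig1 k) (tagnat.sig1 l) => i j x y.
have [eq_ij | ne_ij] := eqVneq i j; last by rewrite mxE add0r.
case: j / eq_ij y => y.
(* Inside one block the join term vanishes because [H] is irreflexive. *)
by rewrite conform_mx_id mxE tagged_asE edge_irrefl addr0 orbF.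
Qed.

Lemma char_poly_hjoin :
  char_poly (adjmx C (hjoin H G))
    = char_poly (hjoin_assoc_mx C H G)
      * \prod_i char_poly (perp_adjmx C (G i)).
Proof.
rewrite char_poly_hjoin_blocks.
(* In this rank-one factorization [j^T] kills the complement, and [j = W e_1] places the row
   [j^T W_j] in the first row of [M_{i,j}]. *)
have onesE i j : const_mx 1 = ones C #|V i| *m (ones C #|V j|)^T.
  by apply/matrixP=> k l; rewrite !mxE big_ord1 !mxE mulr1.
apply: (char_poly_mxblock_split (W := fun i => walk_mx C (G i))
  (Z := fun i => (walk_perp C (G i))^T)
  (Y := fun i => s2val (walk_basis_inv C (G i)))) => [i|i|i|i|i j|i j].
- exact: (s2valP (walk_basis_inv C (G i))).
- exact: (s2valP' (walk_basis_inv C (G i))).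
- exact: adjmx_walk_mx.
- exact: adjmx_perp.
- rewrite -scalemxAl -scalemxAr; congr (_ *: _).
  rewrite onesE -(walk_mx_first C (G i)) -!mulmxA; congr (_ *m _).
  apply/matrixP=> k l; rewrite mxE big_ord1 !mxE.
  by case: eqP => _; rewrite ?mul1r ?mul0r.
by rewrite -scalemxAl onesE -mulmxA ones_perp mulmx0 scaler0.
Qed.

End Join.

(** * From products of linear factors to multisets of eigenvalues *)

Section RootMultisets.
Variable C : numClosedFieldType.

Lemma prod_XsubC_bigcat (I : Type) (r : seq I) (P : pred I) (F : I -> seq C) :
  \prod_(x <- \big[cat/[::]]_(i <- r | P i) F i) ('X - x%:P)
    = \prod_(i <- r | P i) \prod_(x <- F i) ('X - x%:P).
Proof.
by apply: (big_morph (fun s : seq C => \prod_(x <- s) ('X - x%:P)));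
  [move=> s1 s2; apply: big_cat | apply: big_nil].
Qed.

Lemma prod_XsubC_nseq k (x : C) :
  \prod_(y <- nseq k x) ('X - y%:P) = ('X - x%:P) ^+ k.
Proof. by rewrite big_nseq iter_mulr_1. Qed.

(** Cancelling the nonzero [main_poly] from [char_poly_adjmx] lowers the exponent of each main
    eigenvalue by one. *)
Lemma char_poly_perp_adjmx (V : finType) (G : sgraph V) (s t : nat)
    (mu : 'I_t -> C) (m : 'I_t -> nat) :
  injective mu -> (forall k, (0 < m k)%N) ->
  perm_eq (spectrum (adjmx C G)) (\big[cat/[::]]_(k < t) nseq (m k) (mu k)) ->
  (forall k, main_eigenvalue G (mu k) = (k < s)%N) ->
  char_poly (perp_adjmx C G)
    = \prod_(k < t | (k < s)%N) ('X - (mu k)%:P) ^+ (m k - 1)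
      * \prod_(k < t | (s <= k)%N) ('X - (mu k)%:P) ^+ m k.
Proof.
move=> mu_inj m_gt0 specG mainG.
have charA : char_poly (adjmx C G) = \prod_(k < t) ('X - (mu k)%:P) ^+ m k.
  rewrite char_poly_spectrum (perm_big _ specG) prod_XsubC_bigcat.
  by apply: eq_bigr => k _; rewrite prod_XsubC_nseq.
(* Every main eigenvalue is a root of the characteristic polynomial, hence some [mu k]; injectivity
   of [mu] lists it only once. *)
have mainE : main_poly C G = \prod_(k < t | (k < s)%N) ('X - (mu k)%:P).
  rewrite -big_filter -(big_map mu xpredT (fun x => 'X - x%:P)).
  apply/perm_big/uniq_perm; rewrite ?undup_uniq //.
    by rewrite (map_inj_uniq mu_inj) filter_uniq ?index_enum_uniq.
  move=> x; rewrite mem_main_eigenvalues; apply/idP/mapP => [main_x | [k]].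
    have /andP[] := main_x; rewrite eigenvalue_root_char charA rootE.
    rewrite horner_prod => /prodf_eq0[k _]; rewrite -rootE -(prednK (m_gt0 k)).
    rewrite root_exp_XsubC => /eqP xE _.
    by exists k => //; rewrite mem_filter mem_index_enum andbT -mainG -xE.
  by rewrite mem_filter -mainG => /andP[main_k _] ->.
have main_neq0 : main_poly C G != 0 by apply/monic_neq0/monic_prod_XsubC.
apply: (mulfI main_neq0); rewrite -char_poly_adjmx charA mainE mulrA -big_split.
rewrite (bigID (fun k : 'I_t => (k < s)%N)) /=; congr (_ * _).
  by apply: eq_bigr => k _; rewrite -exprS subn1 prednK.
by apply: eq_bigl => k; rewrite -leqNgt.
Qed.

End RootMultisets.

Theorem theorem3p2 (C : numClosedFieldType) (p : nat) (H : sgraph 'I_p)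
    (V : 'I_p -> finType) (G : forall i : 'I_p, sgraph (V i))
    (s t : 'I_p -> nat)
    (mu : forall i : 'I_p, 'I_(t i) -> C) (m : forall i : 'I_p, 'I_(t i) -> nat)
    (le_st : forall i : 'I_p, (s i <= t i)%N)
    (mu_inj : forall i : 'I_p, injective (mu i))
    (m_gt0 : forall (i : 'I_p) (k : 'I_(t i)), (0 < m i k)%N)
    (spectrumG : forall i : 'I_p,
       perm_eq (spectrum (adjmx C (G i)))
               (\big[cat/[::]]_(k < t i) nseq (m i k) (mu i k)))
    (mainG : forall (i : 'I_p) (k : 'I_(t i)),
       main_eigenvalue (G i) (mu i k) = (k < s i)%N) :
  perm_eq (spectrum (adjmx C (hjoin H G)))
    ((\big[cat/[::]]_(i < p)
        \big[cat/[::]]_(k < t i | (k < s i)%N) nseq (m i k - 1)%N (mu i k))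
     ++ (\big[cat/[::]]_(i < p)
           \big[cat/[::]]_(k < t i | (s i <= k)%N) nseq (m i k) (mu i k))
     ++ spectrum (hjoin_assoc_mx C H G)).
Proof.
(* Multisets are compared through their products of linear factors. *)
apply: prod_XsubC_eq; rewrite -char_poly_spectrum char_poly_hjoin !big_cat /=.
rewrite -char_poly_spectrum mulrA [LHS]mulrC; congr (_ * _).
rewrite !prod_XsubC_bigcat -big_split; apply: eq_bigr => i _ /=.
rewrite (char_poly_perp_adjmx (@mu_inj i) (@m_gt0 i) (spectrumG i) (mainG i)).
rewrite !prod_XsubC_bigcat.
by congr (_ * _); apply: eq_bigr => k _; rewrite prod_XsubC_nseq.
Qed.
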